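(* Let $m\ge 2$ and let $p_j=(x_j,y_j)^T\in\mathbb{R}^2$, $j=1,\ldots,m$, be pairwise distinct points. A line $g\subset\mathbb{R}^2$ has minimal geometric $L^2$-distance to the set $\{p_1,\ldots,p_m\}$ if and only if $\bar p\in g$ and the eigenspace of the smallest eigenvalue of $S$ contains a normal vector of $g$. Moreover: (i) If $S_{xy}=0$ and $S_{xx}=S_{yy}$, then any line through $\bar p$ is optimal. (ii) If $S_{xy}=0$ and $S_{xx}<S_{yy}$, then there exists a unique optimal line, namely $x=\bar x$. (iii) If $S_{xy}\neq 0$ or $S_{xx}>S_{yy}$, then there exists a unique optimal line, namely $$y=\frac{2S_{xy}}{S_{xx}-S_{yy}+D}(x-\bar x)+\bar y.$$ Here ''optimal'' means having minimal geometric $L^2$-distance to $\{p_1,\ldots,p_m\}$.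
   Context: A line is written $g=\{q\in\mathbb{R}^2:\langle q,n\rangle=c\}$ with $c\in\mathbb{R}$ and a unit normal vector $n\in S^1$, where $\langle\cdot,\cdot\rangle$ is the Euclidean inner product. The line has minimal geometric $L^2$-distance to $\{p_1,\ldots,p_m\}$ if $(c,n)$ is a global minimum point of $f:\mathbb{R}\times S^1\to\mathbb{R}$, $f(c,n)=\sum_{j=1}^m(c-\langle p_j,n\rangle)^2$ (the sum of squared orthogonal distances of the $p_j$ to $g$). Notation: $\bar p=(\bar x,\bar y)^T=\frac1m\sum_{j=1}^m p_j$, $S_{xx}=\sum_{j=1}^m (x_j-\bar x)^2$, $S_{xy}=\sum_{j=1}^m (x_j-\bar x)(y_j-\bar y)$, $S_{yy}=\sum_{j=1}^m (y_j-\bar y)^2$, $S=\begin{pmatrix}S_{xx}&S_{xy}\\S_{xy}&S_{yy}\end{pmatrix}$, $D=\sqrt{(S_{xx}-S_{yy})^2+4S_{xy}^2}$. *)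

(* Defs.v *)
From HB Require Import structures.
From mathcomp Require Import all_boot all_order all_algebra.
From mathcomp Require Import boolp classical_sets reals.
Set Implicit Arguments.
Unset Strict Implicit.
Unset Printing Implicit Defensive.
Import Order.TTheory GRing.Theory Num.Theory.
Local Open Scope classical_set_scope.
Local Open Scope ring_scope.

(* Points of the plane are row vectors 'rV[R]_2, with the
   x-coordinate [q 0 0] and the y-coordinate [q 0 1]; rows fit MathComp's
   eigenspaces, which consist of the row vectors v with v *m A = a *: v. *)

Definition dot (R : realType) (u v : 'rV[R]_2) : R := \sum_i u 0 i * v 0 i.

Definition unit_circle (R : realType) : set 'rV[R]_2 := [set n | dot n n = 1].

Definition line (R : realType) (c : R) (n : 'rV[R]_2) : set 'rV[R]_2 :=
  [set q | dot q n = c].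

Definition is_line (R : realType) (g : set 'rV[R]_2) : Prop :=
  exists c n, unit_circle n /\ g = line c n.

Definition normal_vector (R : realType) (n : 'rV[R]_2) (g : set 'rV[R]_2) :
  Prop := n != 0 /\ exists c, g = line c n.

Definition sqdist (R : realType) (m : nat) (p : 'I_m -> 'rV[R]_2)
    (c : R) (n : 'rV[R]_2) : R :=
  \sum_(j < m) (c - dot (p j) n) ^+ 2.

Definition global_min (R : realType) (m : nat) (p : 'I_m -> 'rV[R]_2)
    (c : R) (n : 'rV[R]_2) : Prop :=
  unit_circle n /\
  forall c' n', unit_circle n' -> sqdist p c n <= sqdist p c' n'.

(* The pair (c, n) is determined by g up to a common sign, which does not
   affect [sqdist]. *)
Definition optimal (R : realType) (m : nat) (p : 'I_m -> 'rV[R]_2)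
    (g : set 'rV[R]_2) : Prop :=
  exists c n, g = line c n /\ global_min p c n.

Definition centroid (R : realType) (m : nat) (p : 'I_m -> 'rV[R]_2) :
  'rV[R]_2 := m%:R^-1 *: \sum_(j < m) p j.

Definition xbar (R : realType) (m : nat) (p : 'I_m -> 'rV[R]_2) : R :=
  centroid p 0 0.

Definition ybar (R : realType) (m : nat) (p : 'I_m -> 'rV[R]_2) : R :=
  centroid p 0 1.

Definition Sxx (R : realType) (m : nat) (p : 'I_m -> 'rV[R]_2) : R :=
  \sum_(j < m) (p j 0 0 - xbar p) ^+ 2.

Definition Sxy (R : realType) (m : nat) (p : 'I_m -> 'rV[R]_2) : R :=
  \sum_(j < m) (p j 0 0 - xbar p) * (p j 0 1 - ybar p).

Definition Syy (R : realType) (m : nat) (p : 'I_m -> 'rV[R]_2) : R :=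
  \sum_(j < m) (p j 0 1 - ybar p) ^+ 2.

Definition Smx (R : realType) (m : nat) (p : 'I_m -> 'rV[R]_2) : 'M[R]_2 :=
  \matrix_(i, j)
    if i == 0 then (if j == 0 then Sxx p else Sxy p)
    else (if j == 0 then Sxy p else Syy p).

Definition Dpar (R : realType) (m : nat) (p : 'I_m -> 'rV[R]_2) : R :=
  Num.sqrt ((Sxx p - Syy p) ^+ 2 + 4 * Sxy p ^+ 2).

Definition smallest_eigenvalue (R : realType) (k : nat) (A : 'M[R]_k) (a : R) :
  Prop := eigenvalue A a /\ forall b, eigenvalue A b -> a <= b.

Definition unique_optimal (R : realType) (m : nat) (p : 'I_m -> 'rV[R]_2)
    (g : set 'rV[R]_2) : Prop :=
  optimal p g /\ forall g', optimal p g' -> g' = g.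

(* Main.v *)
Require Import Defs.
From HB Require Import structures.
From mathcomp Require Import all_boot all_order all_algebra.
From mathcomp Require Import ring lra.
From mathcomp Require Import boolp classical_sets reals.
Set Implicit Arguments.
Unset Strict Implicit.
Unset Printing Implicit Defensive.
Import Order.TTheory GRing.Theory Num.Theory.
Local Open Scope classical_set_scope.
Local Open Scope ring_scope.

(** By the parallel axis identity, the cost of the line [line c n] splits as
    [m * (c - dot (centroid p) n) ^+ 2 + dot (n *m Smx p) n]
    ([sqdist_parallel_axis]).  The first term vanishes exactly for the lines
    through the centroid, so what remains is to minimise the quadratic form of
    the scatter matrix over unit vectors.

    For a symmetric 2 x 2 matrix [A], put [T := A - (lambda_min A)%:M], where
    [lambda_min A] is the smaller root of the characteristic polynomial and
    [gap A] the distance between the two roots.  The eigenvalues of [T] are 0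
    and [gap A], so Cayley-Hamilton gives [T *m T = gap A *: T]; evaluated at
    a vector [n], this reads [gap A * dot (n *m T) n = dot (n *m T) (n *m T)]
    ([gap_excess]).  Hence [dot (n *m T) n] is nonnegative and vanishes exactly
    when [n *m T = 0], that is, when [n] is an eigenvector for [lambda_min A];
    the case [gap A = 0] is the scalar matrix, for which [T = 0].  Thus
    [lambda_min A] is both the smallest eigenvalue and the minimum of the form
    on the unit circle, reached exactly at the unit eigenvectors.

    Therefore the optimal lines are the lines through the centroid with a
    normal vector in that eigenspace ([optimalP]).  The three explicit cases
    follow by solving the two scalar equations [n *m T = 0]: they are void if
    [T = 0], they give a vertical line if [T 0 0 = 0] and [T != 0], and they
    give a line of slope [T 0 1 / T 0 0] if [0 < T 0 0]. *)

(** * Coordinates in the plane *)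

Lemma row2P (R : realType) (u v : 'rV[R]_2) :
  u = v <-> u 0 0 = v 0 0 /\ u 0 1 = v 0 1.
Proof.
split=> [->//|[e0 e1]]; apply/rowP => i.
case: (unliftP 0 i) => [k ->|-> //].
by rewrite ord1 (_ : lift 0 0 = 1) //; apply/val_inj.
Qed.

Lemma dotE (R : realType) (u v : 'rV[R]_2) :
  dot u v = u 0 0 * v 0 0 + u 0 1 * v 0 1.
Proof.
rewrite /dot big_ord_recl big_ord1 (_ : lift ord0 ord0 = 1) //; exact/val_inj.
Qed.

Lemma mulmx2E (R : realType) (n : 'rV[R]_2) (A : 'M[R]_2) j :
  (n *m A) 0 j = n 0 0 * A 0 j + n 0 1 * A 1 j.
Proof.
rewrite mxE big_ord_recl big_ord1 (_ : lift ord0 ord0 = 1) //; exact/val_inj.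
Qed.

Lemma dotBl (R : realType) (u v w : 'rV[R]_2) :
  dot (u - v) w = dot u w - dot v w.
Proof. by rewrite !dotE !mxE; ring. Qed.

Lemma dotZl (R : realType) k (u v : 'rV[R]_2) : dot (k *: u) v = k * dot u v.
Proof. by rewrite !dotE !mxE; ring. Qed.

Lemma dotZr (R : realType) k (u v : 'rV[R]_2) : dot u (k *: v) = k * dot u v.
Proof. by rewrite !dotE !mxE; ring. Qed.

Lemma dot_sumr (R : realType) m (p : 'I_m -> 'rV[R]_2) n :
  \sum_(j < m) dot (p j) n = dot (\sum_(j < m) p j) n.
Proof.
rewrite dotE !summxE !mulr_suml -big_split /=.
by apply: eq_bigr => j _; rewrite dotE.
Qed.

Lemma dot_ge0 (R : realType) (u : 'rV[R]_2) : 0 <= dot u u.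
Proof. by rewrite dotE -!expr2 addr_ge0 ?sqr_ge0. Qed.

Lemma dot_eq0 (R : realType) (u : 'rV[R]_2) : dot u u = 0 <-> u = 0.
Proof.
split=> [|->]; last by rewrite dotE !mxE; ring.
move=> /eqP; rewrite dotE -!expr2 paddr_eq0 ?sqr_ge0 // !sqrf_eq0.
by move=> /andP[/eqP u0 /eqP u1]; apply/row2P; rewrite !mxE.
Qed.

Lemma dot_gt0 (R : realType) (u : 'rV[R]_2) : u != 0 -> 0 < dot u u.
Proof.
by move=> u0; rewrite lt_def dot_ge0 andbT; apply: contra u0 => /eqP/dot_eq0 ->.
Qed.

Lemma unit_circle_neq0 (R : realType) (n : 'rV[R]_2) :
  unit_circle n -> n != 0.
Proof.
rewrite /unit_circle /= => n1; apply/eqP => /dot_eq0; rewrite n1.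
by apply/eqP; rewrite oner_eq0.
Qed.

Lemma unit_circle_normalize (R : realType) (n : 'rV[R]_2) :
  n != 0 -> unit_circle ((Num.sqrt (dot n n))^-1 *: n).
Proof.
move=> /dot_gt0 n0; rewrite /unit_circle /= dotZl dotZr mulrA -expr2 exprVn.
by rewrite sqr_sqrtr ?ltW // mulVf ?gt_eqF.
Qed.

Lemma line_scale (R : realType) k c (n : 'rV[R]_2) :
  k != 0 -> line (k * c) (k *: n) = line c n.
Proof.
move=> k0; apply/seteqP; split=> q; rewrite /line /= dotZr; last by move->.
exact: mulfI.
Qed.

(** * The smallest eigenvalue of a symmetric 2 x 2 matrix *)

Lemma discriminant_ge0 (R : realType) (x y : R) : 0 <= x ^+ 2 + 4 * y ^+ 2.
Proof. by rewrite addr_ge0 ?sqr_ge0 // mulr_ge0 ?sqr_ge0. Qed.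

Section SymmetricMatrix.
Variables (R : realType) (A : 'M[R]_2).
Hypothesis symA : A 1 0 = A 0 1.

(** The square root of the discriminant of the characteristic polynomial, that
    is, the distance between its two roots. *)
Definition gap : R := Num.sqrt ((A 0 0 - A 1 1) ^+ 2 + 4 * A 0 1 ^+ 2).

Definition lambda_min : R := (A 0 0 + A 1 1 - gap) / 2.

(** [n *m (A - lambda_min%:M)], as a function of [n]. *)
Definition residual (n : 'rV[R]_2) : 'rV[R]_2 := n *m A - lambda_min *: n.

Lemma gap_ge0 : 0 <= gap.
Proof. exact: sqrtr_ge0. Qed.

Lemma sqr_gap : gap ^+ 2 = (A 0 0 - A 1 1) ^+ 2 + 4 * A 0 1 ^+ 2.
Proof. by rewrite sqr_sqrtr // discriminant_ge0. Qed.

Lemma residualE (n : 'rV[R]_2) :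
  residual n 0 0 = (A 0 0 - A 1 1 + gap) / 2 * n 0 0 + A 0 1 * n 0 1 /\
  residual n 0 1 = A 0 1 * n 0 0 + (A 1 1 - A 0 0 + gap) / 2 * n 0 1.
Proof.
rewrite /residual mxE [X in X + _]mulmx2E [(n *m A - _) 0 1]mxE.
rewrite [X in _ /\ X + _ = _]mulmx2E !mxE symA /lambda_min.
by split; field.
Qed.

Lemma dot_residual (n : 'rV[R]_2) :
  dot (residual n) n = dot (n *m A) n - lambda_min * dot n n.
Proof. by rewrite dotBl dotZl. Qed.

(** Cayley-Hamilton for [A - lambda_min%:M], whose trace is [gap] and whose
    determinant is 0. *)
Lemma gap_excess (n : 'rV[R]_2) :
  gap * dot (residual n) n = dot (residual n) (residual n).
Proof.
have [r0 r1] := residualE n; rewrite !dotE r0 r1.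
(* The two sides agree modulo the equation defining [gap]. *)
apply/eqP; rewrite -subr_eq0 [X in X == 0](_ : _ =
  (n 0 0 ^+ 2 + n 0 1 ^+ 2) / 4
  * (gap ^+ 2 - ((A 0 0 - A 1 1) ^+ 2 + 4 * A 0 1 ^+ 2))); last by field.
by rewrite sqr_gap subrr mulr0.
Qed.

Lemma gap0_residual (n : 'rV[R]_2) : gap = 0 -> residual n = 0.
Proof.
move=> g0; have := sqr_gap; rewrite g0 expr0n /= => disc0.
have b0 : A 0 1 = 0.
  apply/eqP; rewrite -sqrf_eq0; apply/eqP.
  by have := sqr_ge0 (A 0 0 - A 1 1); have := sqr_ge0 (A 0 1); lra.
have e : A 0 0 - A 1 1 = 0.
  apply/eqP; rewrite -sqrf_eq0; apply/eqP.
  by move: disc0; rewrite b0; lra.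
have [r0 r1] := residualE n; apply/row2P; rewrite r0 r1 !mxE b0 g0.
have -> : A 1 1 - A 0 0 = 0 by lra.
by rewrite e; split; ring.
Qed.

Lemma excess_ge0 (n : 'rV[R]_2) : 0 <= dot (residual n) n.
Proof.
have [g0|gN0] := eqVneq gap 0.
  by rewrite (gap0_residual _ g0) dotE !mxE !mul0r addr0.
have g_gt0 : 0 < gap by rewrite lt_def gN0 gap_ge0.
by rewrite -(pmulr_rge0 _ g_gt0) gap_excess dot_ge0.
Qed.

Lemma excess_eq0 (n : 'rV[R]_2) : dot (residual n) n = 0 <-> residual n = 0.
Proof.
split=> [e0|->]; last by rewrite dotE !mxE !mul0r addr0.
by apply/dot_eq0; rewrite -gap_excess e0 mulr0.
Qed.

(** [A - lambda_min%:M] is symmetric of determinant 0, so a nonzero first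
    column spans its column space and the first residual equation implies the
    second. *)
Lemma residual_eq0_slope (n : 'rV[R]_2) : 0 < A 0 0 - A 1 1 + gap ->
  residual n = 0 <->
  n 0 0 = - (2 * A 0 1 / (A 0 0 - A 1 1 + gap)) * n 0 1.
Proof.
move=> a0; have aN0 : A 0 0 - A 1 1 + gap != 0 by rewrite gt_eqF.
have [r0 r1] := residualE n; split=> [r|n0].
  move: r0; rewrite r mxE => r0.
  apply: (mulfI aN0).
  rewrite [RHS](_ : _ = - (2 * A 0 1 * n 0 1)); first by lra.
  by field.
apply/row2P; rewrite r0 r1 !mxE n0; split; first by field.
apply: (mulfI aN0); rewrite mulr0.
rewrite [LHS](_ : _ =
  n 0 1 / 2 * (gap ^+ 2 - ((A 0 0 - A 1 1) ^+ 2 + 4 * A 0 1 ^+ 2))).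
  by rewrite sqr_gap subrr mulr0.
by field.
Qed.

Lemma lambda_min_eigenvector : exists2 n : 'rV[R]_2, n != 0 & residual n = 0.
Proof.
have [a0|a_le0] := ltP 0 (A 0 0 - A 1 1 + gap).
  exists (\row_j if j == 0 then - (2 * A 0 1 / (A 0 0 - A 1 1 + gap)) else 1).
    apply/eqP => /row2P[_]; rewrite !mxE /=; apply/eqP; exact: oner_neq0.
  by apply/(residual_eq0_slope _ a0); rewrite !mxE /= mulr1.
(* Otherwise [A] is diagonal with smallest entry [A 0 0], and the first basis
   vector works. *)
exists (delta_mx 0 0).
  by apply/eqP => /row2P[]; rewrite !mxE /= => /eqP; rewrite oner_eq0.
have g2 := sqr_gap; have g0 := gap_ge0; have b2 := sqr_ge0 (A 0 1).
have a_ge0 : gap ^+ 2 <= (A 1 1 - A 0 0) ^+ 2.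
  by rewrite ler_sqr ?nnegrE //; lra.
have b0 : A 0 1 = 0.
  apply/eqP; rewrite -sqrf_eq0; apply/eqP; nra.
have a0 : A 0 0 - A 1 1 + gap = 0.
  have : gap ^+ 2 = (A 1 1 - A 0 0) ^+ 2 by rewrite g2 b0; ring.
  by move=> /eqP; rewrite eqrXn2 //; [move=> /eqP|]; lra.
have [r0 r1] := residualE (delta_mx 0 0).
by apply/row2P; rewrite r0 r1 a0 b0 !mxE /=; split; ring.
Qed.

Lemma eigenspaceP_residual (n : 'rV[R]_2) :
  (n <= eigenspace A lambda_min)%MS <-> residual n = 0.
Proof.
rewrite /residual; split=> [/eigenspaceP->|/eqP]; first exact: subrr.
by rewrite subr_eq0 => /eqP ?; apply/eigenspaceP.
Qed.

Lemma smallest_eigenvalueP (a : R) :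
  smallest_eigenvalue A a <-> a = lambda_min.
Proof.
have ev : eigenvalue A lambda_min.
  have [n n0 /eigenspaceP_residual nA] := lambda_min_eigenvector.
  by apply/eigenvalueP; exists n => //; apply/eigenspaceP.
have min b : eigenvalue A b -> lambda_min <= b.
  case/eigenvalueP => v vA /dot_gt0 v0; have := excess_ge0 v.
  by rewrite dot_residual vA dotZl -mulrBl pmulr_lge0 // subr_ge0.
split=> [[eva mina]|-> //]; apply/eqP; rewrite eq_le.
by rewrite (mina _ ev) (min _ eva).
Qed.

End SymmetricMatrix.

(** * Optimal lines *)

Section OptimalLines.
Variables (R : realType) (m : nat) (p : 'I_m -> 'rV[R]_2).

Lemma Smx_sym : Smx p 1 0 = Smx p 0 1.
Proof. by rewrite !mxE. Qed.

Lemma gap_Smx : gap (Smx p) = Dpar p.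
Proof. by rewrite /gap !mxE. Qed.

Lemma qform_Smx (n : 'rV[R]_2) :
  dot (n *m Smx p) n = \sum_(j < m) (dot (p j - centroid p) n) ^+ 2.
Proof.
rewrite dotE !mulmx2E !mxE /= /Sxx /Sxy /Syy.
rewrite !mulr_sumr -!big_split /= !mulr_suml -big_split /=.
by apply: eq_bigr => j _; rewrite dotE /xbar /ybar !mxE; ring.
Qed.

Hypothesis m_gt0 : (0 < m)%N.

(** The mixed term vanishes because the deviations from the centroid sum to
    zero. *)
Lemma sqdist_parallel_axis c (n : 'rV[R]_2) :
  sqdist p c n = m%:R * (c - dot (centroid p) n) ^+ 2 + dot (n *m Smx p) n.
Proof.
have m0 : m%:R != 0 :> R by rewrite pnatr_eq0 -lt0n.
have dev0 : \sum_(j < m) dot (p j - centroid p) n = 0.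
  under eq_bigr do rewrite dotBl.
  rewrite sumrB dot_sumr sumr_const card_ord /centroid dotZl.
  by rewrite -[X in _ - X]mulr_natl mulVKf // subrr.
set e := c - _; rewrite qform_Smx /sqdist.
transitivity (\sum_(j < m) (e ^+ 2 - 2 * e * dot (p j - centroid p) n
                            + dot (p j - centroid p) n ^+ 2)).
  by apply: eq_bigr => j _; rewrite /e dotBl; ring.
rewrite big_split sumrB /= -[X in _ - X + _]mulr_sumr dev0 mulr0 subr0.
by rewrite sumr_const card_ord mulr_natl.
Qed.

Lemma sqdist_residual c (n : 'rV[R]_2) : unit_circle n ->
  sqdist p c n = lambda_min (Smx p) +
    (m%:R * (c - dot (centroid p) n) ^+ 2 + dot (residual (Smx p) n) n).
Proof.
move=> n1; rewrite sqdist_parallel_axis dot_residual n1; ring.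
Qed.

Lemma global_minP c (n : 'rV[R]_2) :
  global_min p c n <->
  [/\ unit_circle n, c = dot (centroid p) n & residual (Smx p) n = 0].
Proof.
have m0 : 0 < m%:R :> R by rewrite ltr0n.
have exc_ge0 v := excess_ge0 Smx_sym v.
split=> [[n1 min]|[n1 -> r0]].
  (* Compare with the line through the centroid normal to an eigenvector. *)
  have [v v0 rv0] := lambda_min_eigenvector Smx_sym.
  have w1 := unit_circle_normalize v0; set w := _ *: v in w1.
  have rw0 : residual (Smx p) w = 0.
    by apply/eigenspaceP_residual/scalemx_sub/eigenspaceP_residual.
  have := min (dot (centroid p) w) w w1.
  rewrite !sqdist_residual // subrr expr0n mulr0 rw0 add0r.
  have -> : dot 0 w = 0 by rewrite dotE !mxE !mul0r addr0.
  rewrite addr0 gerDl => le0.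
  have sq0 := sqr_ge0 (c - dot (centroid p) n).
  have := mulr_ge0 (ltW m0) sq0; have := exc_ge0 n => ex0 t0.
  split=> //; last by apply/(excess_eq0 Smx_sym); lra.
  have /eqP : m%:R * (c - dot (centroid p) n) ^+ 2 = 0 by lra.
  by rewrite mulf_eq0 gt_eqF //= sqrf_eq0 subr_eq0 => /eqP.
split=> // c' n' n'1; rewrite !sqdist_residual // subrr expr0n mulr0 r0 add0r.
have -> : dot 0 n = 0 by rewrite dotE !mxE !mul0r addr0.
by rewrite lerD2l addr_ge0 // mulr_ge0 ?sqr_ge0 // ltW.
Qed.

(** Normals need not be unit vectors here: both the residual equation and the
    line are insensitive to rescaling the normal. *)
Lemma optimalP (g : set 'rV[R]_2) :
  optimal p g <->
  exists n : 'rV[R]_2, [/\ n != 0, residual (Smx p) n = 0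
                         & g = line (dot (centroid p) n) n].
Proof.
split=> [[c [n [-> /global_minP[n1 -> r0]]]]|[n [n0 r0 ->]]].
  by exists n; split=> //; exact: unit_circle_neq0.
set k := (Num.sqrt (dot n n))^-1.
have k0 : k != 0 by rewrite invr_eq0 sqrtr_eq0 -ltNge dot_gt0.
exists (k * dot (centroid p) n), (k *: n); split; first by rewrite line_scale.
apply/global_minP; split; rewrite ?dotZr //; first exact: unit_circle_normalize.
by apply/eigenspaceP_residual/scalemx_sub/eigenspaceP_residual.
Qed.

Lemma optimal_eigenspaceP (g : set 'rV[R]_2) :
  optimal p g <->
  g (centroid p) /\
  exists (a : R) (n : 'rV[R]_2),
    [/\ smallest_eigenvalue (Smx p) a, (n <= eigenspace (Smx p) a)%MS
      & normal_vector n g].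
Proof.
rewrite optimalP; split=> [[n [n0 r0 ->]]|].
  split=> //; exists (lambda_min (Smx p)), n.
  split; [exact/(smallest_eigenvalueP Smx_sym)|exact/eigenspaceP_residual|].
  by split=> //; exists (dot (centroid p) n).
case=> gc [_ [n [/(smallest_eigenvalueP Smx_sym)-> /eigenspaceP_residual r0]]].
case=> n0 [c gE]; exists n; split=> //; move: gc; rewrite gE.
by rewrite /line /= => ->.
Qed.

Lemma unique_optimal_line (g : set 'rV[R]_2) :
  (forall n : 'rV[R]_2, n != 0 -> residual (Smx p) n = 0 ->
     line (dot (centroid p) n) n = g) ->
  unique_optimal p g.
Proof.
move=> lineE; split=> [|g' /optimalP[n [n0 r0 ->]]]; last exact: lineE.
have [n n0 r0] := lambda_min_eigenvector Smx_sym.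
by apply/optimalP; exists n; rewrite lineE.
Qed.

Lemma optimal_isotropic (g : set 'rV[R]_2) :
  Sxy p = 0 -> Sxx p = Syy p -> is_line g -> g (centroid p) -> optimal p g.
Proof.
move=> b0 ad [c [n [n1 ->]]] gc; apply/optimalP; exists n.
split; [exact: unit_circle_neq0| |by move: gc; rewrite /line /= => ->].
apply: gap0_residual; first exact: Smx_sym.
by rewrite gap_Smx /Dpar b0 ad subrr !expr0n /= mulr0 addr0 sqrtr0.
Qed.

Lemma unique_optimal_vertical : Sxy p = 0 -> Sxx p < Syy p ->
  unique_optimal p [set q : 'rV[R]_2 | q 0 0 = xbar p].
Proof.
move=> b0 ad; apply: unique_optimal_line => n n0 r0.
have D0 : 0 <= Dpar p := sqrtr_ge0 _.
have [_] := residualE Smx_sym n; rewrite r0 gap_Smx !mxE /=.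
rewrite b0 mul0r add0r => /esym/eqP.
rewrite mulf_eq0 gt_eqF /=; last by lra.
move=> /eqP n1.
have n00 : n 0 0 != 0.
  by apply: contra n0 => /eqP n00; apply/eqP/row2P; rewrite !mxE.
apply/seteqP; split=> q; rewrite /line /= !dotE n1 !mulr0 !addr0.
  exact: mulIf.
by rewrite /xbar => ->.
Qed.

Lemma slope_denom_gt0 : Sxy p <> 0 \/ Sxx p > Syy p ->
  0 < Sxx p - Syy p + Dpar p.
Proof.
have D0 : 0 <= Dpar p := sqrtr_ge0 _.
case=> [/eqP b0|]; last by lra.
have b2 : 0 < Sxy p ^+ 2 by rewrite lt_def sqrf_eq0 b0 sqr_ge0.
have D2 : Dpar p ^+ 2 = (Sxx p - Syy p) ^+ 2 + 4 * Sxy p ^+ 2.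
  by rewrite sqr_sqrtr // discriminant_ge0.
rewrite ltNge; apply/negP => le0.
have : Dpar p ^+ 2 <= (Syy p - Sxx p) ^+ 2 by rewrite ler_sqr ?nnegrE //; lra.
by rewrite D2; nra.
Qed.

Lemma unique_optimal_slope : Sxy p <> 0 \/ Sxx p > Syy p ->
  unique_optimal p
    [set q : 'rV[R]_2 |
      q 0 1 = 2 * Sxy p / (Sxx p - Syy p + Dpar p) * (q 0 0 - xbar p) + ybar p].
Proof.
move=> /slope_denom_gt0 den0; apply: unique_optimal_line => n n0.
have := @residual_eq0_slope _ _ Smx_sym n; rewrite gap_Smx !mxE /=.
move=> /(_ den0)[+ _] => /[apply].
set s := 2 * _ / _ => n00.
have n1 : n 0 1 != 0.
  apply: contra n0 => /eqP n1.
  by apply/eqP/row2P; rewrite !mxE n00 n1 mulr0.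
apply/seteqP; split=> q; rewrite /line /= !dotE n00 /xbar /ybar => qE.
  apply: (mulIf n1); lra.
rewrite qE; ring.
Qed.

End OptimalLines.

Theorem theorem2 (R : realType) (m : nat) (hm : (2 <= m)%N)
    (p : 'I_m -> 'rV[R]_2) (hp : injective p) :
  [/\ forall g : set 'rV[R]_2, is_line g ->
        (optimal p g <->
         g (centroid p) /\
         exists (a : R) (n : 'rV[R]_2),
           [/\ smallest_eigenvalue (Smx p) a,
               (n <= eigenspace (Smx p) a)%MS
             & normal_vector n g]),
      Sxy p = 0 -> Sxx p = Syy p ->
        forall g : set 'rV[R]_2, is_line g -> g (centroid p) -> optimal p g,
      Sxy p = 0 -> Sxx p < Syy p ->
        unique_optimal p [set q : 'rV[R]_2 | q 0 0 = xbar p]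
    & Sxy p <> 0 \/ Sxx p > Syy p ->
        unique_optimal p
          [set q : 'rV[R]_2 |
            q 0 1 = 2 * Sxy p / (Sxx p - Syy p + Dpar p) * (q 0 0 - xbar p)
                    + ybar p]].
Proof.
have m_gt0 : (0 < m)%N by exact: ltnW.
split.
- by move=> g _; exact: optimal_eigenspaceP.
- by move=> b0 ad g; exact: optimal_isotropic.
- exact: unique_optimal_vertical.
- exact: unique_optimal_slope.
Qed.
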